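(* Let $T$ be an $n$-vertex tree with radius $r$. Then $\max(r, \log n) \le f_T(T) \le r + 2\lceil \log n \rceil + 1$.
   Context: $\log$ is base 2. All graphs are finite, simple, connected with at least 4 vertices. The radius of a tree is $\min_{v}\max_{u} d(u,v)$. A vertex-separating tree system of a graph $G$ is a collection of subgraphs of $G$, each a tree, such that for every pair of distinct vertices $u,v$ some tree in the collection contains exactly one of $u$ and $v$. $f_T(G)$ denotes the minimum size of a vertex-separating tree system of $G$. *)

(* Defs.v *)
From HB Require Import structures.
From mathcomp Require Import all_boot all_order all_algebra.
From mathcomp Require Import boolp reals exp.

Set Implicit Arguments.
Unset Strict Implicit.
Unset Printing Implicit Defensive.

Import Order.TTheory GRing.Theory Num.Theory.

Section Graphs.
Variable V : finType.

(* A finite simple graph whose vertices are drawn from V: a vertex set together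
   with a set of edges, each edge a two-element set of vertices. The vertex set
   need not be all of V, so a graph and its subgraphs inhabit the same type. *)
Definition graph_axiom (A : {set V} * {set {set V}}) : bool :=
  [forall a in A.2, (#|a| == 2) && (a \subset A.1)].

Record graph := Graph {
  graph_val :> {set V} * {set {set V}};
  graph_valP : graph_axiom graph_val }.

HB.instance Definition _ := [isSub for graph_val].
HB.instance Definition _ := [Finite of graph by <:].

Implicit Types (G H : graph) (S : {set graph}).

Definition vertices G : {set V} := (graph_val G).1.
Definition edges G : {set {set V}} := (graph_val G).2.

Definition adj G : rel V := fun u v => [set u; v] \in edges G.

Definition subgraph H G : bool :=
  (vertices H \subset vertices G) && (edges H \subset edges G).

Definition connected_graph G : Prop :=
  vertices G != set0 /\ {in vertices G &, forall u v, connect (adj G) u v}.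

(* A cycle is a cyclic sequence of at least three distinct vertices;
   ucycle also accepts the shorter sequences [::] and [:: u; v]. *)
Definition acyclic G : Prop :=
  forall c : seq V, ucycle (adj G) c -> size c < 3.

Definition is_tree G : Prop := connected_graph G /\ acyclic G.

(* Length of a shortest path from u to v. A path has fewer than #|V| edges, so
   #|V| is the value exactly when there is no path. *)
Definition dist G (u v : V) : nat :=
  \big[minn/#|V|]_(k < #|V| | [exists p : k.-tuple V,
      [&& path (adj G) u p, uniq (u :: p) & last u p == v]]) k.

(* The default value #|V| bounds every eccentricity, so it only matters when
   the vertex set is empty. *)
Definition radius G : nat :=
  \big[minn/#|V|]_(v in vertices G) \max_(u in vertices G) dist G u v.

Definition separating_tree_system G S : Prop :=
  {in S, forall H, subgraph H G /\ is_tree H} /\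
  {in vertices G &, forall u v, u != v ->
     exists2 H, H \in S & (u \in vertices H) (+) (v \in vertices H)}.

Lemma vertex_graph_axiom (v : V) : graph_axiom ([set v], set0).
Proof. by apply/forall_inP => a; rewrite inE. Qed.

Definition vertex_graph (v : V) : graph := Graph (vertex_graph_axiom v).

Lemma vertex_graph_tree v : is_tree (vertex_graph v).
Proof.
split.
  split; first by apply/set0Pn; exists v; rewrite set11.
  by move=> x y /set1P -> /set1P ->; exact: connect0.
by case=> [|x [|y c]] //; rewrite /ucycle /= {1}/adj inE.
Qed.

Lemma separating_tree_system_exists G :
  exists m, `[< exists2 S, separating_tree_system G S & #|S| = m >].
Proof.
exists #|vertex_graph @: vertices G|; apply/asboolP.
exists (vertex_graph @: vertices G) => //; split.
  move=> _ /imsetP[v vG ->]; split; last exact: vertex_graph_tree.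
  by rewrite /subgraph sub1set vG sub0set.
move=> u v uG _ uv; exists (vertex_graph u); first exact: imset_f.
by rewrite !inE eqxx eq_sym (negbTE uv).
Qed.

(* The minimum size of a vertex-separating tree system of G. *)
Definition f_T G : nat := ex_minn (separating_tree_system_exists G).

End Graphs.

Definition log2 (R : realType) (x : R) : R := (ln x / ln 2)%R.

(* Main.v *)
(* Lower bound: a longest path with D edges has radius <= ceil(D/2), since the
   distance from its middle vertex to any vertex is at most that. A subtree meets
   the path in a subpath, so it separates at most two of the D pairs of
   consecutive vertices, whence D <= 2 |S|. The logarithmic bound holds because
   vertices have distinct traces on a separating system.
   Upper bound: root the tree at a center. The balls of radius 0, ..., r-1 around
   the root separate vertices on different levels. Label vertices by a
   depth-first order; distinct vertices of a level then have descendants whose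
   labels are separated by the order, and for two such sets A < B of numbers
   below 2^k some bit takes some value on exactly one of them: at the highest bit
   that is not constant on the union of A and B, they cannot both attain both
   values. Hence the 2k subtrees spanned by the root and the vertices whose label
   has a given value at a given bit suffice. *)
Require Import Defs.
From mathcomp Require Import all_boot all_order all_algebra.
From mathcomp Require Import boolp reals exp.
From mathcomp Require Import zify.

Set Implicit Arguments.
Unset Strict Implicit.
Unset Printing Implicit Defensive.

Import Order.TTheory GRing.Theory Num.Theory.

(** * Minima over a finite type with a default value *)

Section BigMinn.
Variables (I : finType) (P : pred I) (F : I -> nat) (z : nat).

Lemma bigminn_le i : P i -> \big[minn/z]_(j | P j) F j <= F i.
Proof. by move=> Pi; rewrite -minEnat -leEnat; exact: (bigmin_le_cond _ F Pi). Qed.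

Lemma bigminn_attained :
  \big[minn/z]_(j | P j) F j < z ->
  exists2 i, P i & \big[minn/z]_(j | P j) F j = F i.
Proof.
apply: (big_ind (fun m => m < z -> exists2 i, P i & m = F i)).
- by rewrite ltnn.
- by move=> x y IHx IHy; rewrite /minn; case: ifP.
- by move=> i Pi _; exists i.
Qed.

End BigMinn.

(** * Binary digits that distinguish two ordered blocks of numbers *)

Section SeparatingBit.
Variables (I : finType) (f : I -> nat).

Lemma separating_bit (A B : {set I}) k :
    A != set0 -> B != set0 -> (forall x, f x < 2 ^ k) ->
    {in A & B, forall x y, f x < f y} ->
  exists j : 'I_k, exists b : bool,
    [exists x in A, odd (f x %/ 2 ^ j) == b]
      (+) [exists y in B, odd (f y %/ 2 ^ j) == b].
Proof.
move=> /set0Pn[x0 x0A] /set0Pn[y0 y0B] fk ltAB; apply: contrapT => nosep.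
have agree (j : nat) b : j < k ->
    [exists x in A, odd (f x %/ 2 ^ j) == b]
      = [exists y in B, odd (f y %/ 2 ^ j) == b].
  move=> jk; apply: contrapT => ne; apply: nosep; exists (Ordinal jk), b.
  by move: ne => /=; case: [exists x in A, _]; case: [exists y in B, _].
have divS m j : m %/ 2 ^ j = odd (m %/ 2 ^ j) + (m %/ 2 ^ j.+1).*2.
  by rewrite expnSr divnMA divn2 odd_double_half.
(* Without a separating bit, [A] and [B] agree on ever more leading bits; at [i = k] this
   contradicts [ltAB]. *)
suff same i : i <= k -> {in A & B, forall x y, f x %/ 2 ^ (k - i) = f y %/ 2 ^ (k - i)}.
  have := same k (leqnn k) x0 y0 x0A y0B; have := ltAB x0 y0 x0A y0B.
  by rewrite subnn expn0 !divn1 => /[swap] ->; rewrite ltnn.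
elim: i => [|i IHi] ik x y xA yB.
  by rewrite subn0 !divn_small.
have {IHi} := IHi (ltnW ik); have -> : k - i = (k - i.+1).+1 by lia.
have : k - i.+1 < k by lia.
move: (k - i.+1) => j jk IHi.
apply/eqP; rewrite eqn_leq (leq_div2r _ (ltnW (ltAB x y xA yB))) leqNgt /=.
apply/negP.
rewrite (divS (f x)) (divS (f y)) (IHi x y xA yB) ltn_add2r => bits.
(* Here [x] has bit 0 and [y] has bit 1. By [agree], some [x'] in [A] has bit 1 and some [y'] in [B]
   has bit 0; with equal leading bits this reverses the order. *)
have [x' x'A x'1] : exists2 x', x' \in A & odd (f x' %/ 2 ^ j).
  have : [exists y in B, odd (f y %/ 2 ^ j) == true].
    by apply/exists_inP; exists y => //; move: bits; case: odd; case: odd.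
  by rewrite -agree // => /exists_inP[x' ? /eqP ?]; exists x'.
have [y' y'B y'0] : exists2 y', y' \in B & ~~ odd (f y' %/ 2 ^ j).
  have : [exists x in A, odd (f x %/ 2 ^ j) == false].
    by apply/exists_inP; exists x => //; move: bits; case: odd; case: odd.
  by rewrite agree // => /exists_inP[y' ? /eqP yo]; exists y'; rewrite ?yo.
have := leq_div2r (2 ^ j) (ltnW (ltAB x' y' x'A y'B)).
by rewrite (divS (f x')) (divS (f y')) x'1 (negbTE y'0) (IHi x' y') // add0n ltnn.
Qed.

End SeparatingBit.

(** * Distances and simple paths *)

Section Adjacency.
Variables (V : finType) (G : graph V).

Lemma edgeP a : a \in edges G -> (#|a| == 2) && (a \subset vertices G).
Proof. by move=> aG; have /forall_inP := graph_valP G; apply. Qed.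

Lemma adj_sym : symmetric (adj G).
Proof. by move=> x y; rewrite /adj setUC. Qed.

Lemma adj_irr x : adj G x x = false.
Proof. by apply/negP => /edgeP; rewrite setUid cards1. Qed.

Lemma adj_vertices x y : adj G x y -> (x \in vertices G) && (y \in vertices G).
Proof. by move=> /edgeP /andP[_]; rewrite subUset !sub1set. Qed.

Lemma dist_le u p : path (adj G) u p -> dist G u (last u p) <= size p.
Proof.
case/shortenP => q qp uq sq; have qV : size q < #|V|.
  by rewrite -[(size q).+1]/(size (u :: q)) -(card_uniqP uq) max_card.
apply: leq_trans (uniq_leq_size _ sq); last by case/andP: uq.
apply: (@bigminn_le _ _ _ _ (Ordinal qV)) => /=.
by apply/existsP; exists (in_tuple q); apply/and3P.
Qed.

Lemma dist_attained u v : connect (adj G) u v ->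
  dist G u v < #|V| /\
  exists p, [/\ path (adj G) u p, uniq (u :: p), last u p = v & size p = dist G u v].
Proof.
case/connectP => p0 /shortenP[p pp up _] v_eq.
have ltV : dist G u v < #|V|.
  rewrite v_eq; apply: leq_ltn_trans (dist_le pp) _.
  by rewrite -[(size p).+1]/(size (u :: p)) -(card_uniqP up) max_card.
split=> //; have [k /existsP[q /and3P[qp uq /eqP lq]] dE] := bigminn_attained ltV.
by exists q; split=> //; rewrite size_tuple -dE.
Qed.

Lemma connect_uniq_path u v : connect (adj G) u v ->
  exists p, [/\ path (adj G) u p, uniq (u :: p) & last u p = v].
Proof. by case/dist_attained => _ [p [? ? ? _]]; exists p. Qed.

End Adjacency.

(** * Unique paths and convexity of subtrees in acyclic graphs *)

Section Acyclic.
Variable V : finType.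

Fixpoint nonbacktracking (s : seq V) : bool :=
  if s is x :: s' then
    (if s' is _ :: z :: _ then x != z else true) && nonbacktracking s'
  else true.

Lemma uniq_nonbacktracking s : uniq s -> nonbacktracking s.
Proof.
elim: s => //= x s IHs /andP[xs us]; rewrite IHs // andbT.
by case: s xs {IHs us} => [|y [|z s]] //; rewrite !inE !negb_or => /and3P[].
Qed.

(** The condition only concerns vertices two steps apart, so gluing creates a single new case: the
    two neighbours of [x]. *)
Lemma nonbacktracking_cat s1 x s2 :
    nonbacktracking (rcons s1 x) -> nonbacktracking (x :: s2) ->
    [|| nilp s1, nilp s2 | last x s1 != head x s2] ->
  nonbacktracking (s1 ++ x :: s2).
Proof.
elim: s1 => [|a [|b s1] IHs] // nb1 nb2.
  by case: s2 nb2 {IHs} => [|z s2] //= -> ->.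
case/andP: nb1 => nba nb1 junction.
have {}IHs := IHs nb1 nb2 junction; apply/andP; split=> //.
by case: s1 nba {IHs nb1 junction} => [|? ?].
Qed.

Variable G : graph V.
Hypothesis acG : acyclic G.

(* The shortest closed segment of a walk is a cycle of the graph unless it has
   the form x, y, x. *)
Lemma nonbacktracking_uniq s :
  sorted (adj G) s -> nonbacktracking s -> uniq s.
Proof.
elim: s => // x s IHs xs /andP[nbx nbs].
have us : uniq s by apply: IHs (path_sorted xs) nbs.
rewrite cons_uniq us andbT; apply/negP => x_s.
case/splitPr: x_s xs us nbx {IHs nbs} => s1 s2.
rewrite [sorted _ _]/= cat_path => /andP[xs1 /= /andP[s1x _]].
rewrite cat_uniq cons_uniq /= negb_or => /and3P[us1 /andP[xs1' _] _] nbx.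
have : size (x :: s1) < 3.
  by apply: acG; rewrite /ucycle /= rcons_path xs1 s1x xs1' us1.
case: s1 xs1 s1x nbx {xs1' us1} => [|y [|z s1]] //=; first by rewrite adj_irr.
by rewrite eqxx.
Qed.

Lemma sorted_adj_rev s : sorted (adj G) (rev s) = sorted (adj G) s.
Proof. by rewrite rev_sorted; apply: eq_sorted => x y; rewrite adj_sym. Qed.

Lemma uniq_cat_at_vertex s1 x s2 :
    sorted (adj G) (rcons s1 x) -> uniq (rcons s1 x) ->
    path (adj G) x s2 -> uniq (x :: s2) ->
    [|| nilp s1, nilp s2 | last x s1 != head x s2] ->
  uniq (s1 ++ x :: s2).
Proof.
move=> so1 u1 so2 u2 junction; apply: nonbacktracking_uniq.
  by rewrite sorted_cat_cons so1.
by apply: nonbacktracking_cat => //; apply: uniq_nonbacktracking.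
Qed.

Lemma acyclic_path_unique x p q :
    path (adj G) x p -> uniq (x :: p) -> path (adj G) x q -> uniq (x :: q) ->
  last x p = last x q -> p = q.
Proof.
elim: p x q => [|a p IHp] x [|b q] //=.
- by move=> _ _ _ /andP[xq _] xE; rewrite {1}xE mem_last in xq.
- by move=> _ /andP[xp _] _ _ xE; rewrite -{1}xE mem_last in xp.
move=> /andP[xa ap] /andP[xp up] /andP[xb bq] /andP[xq uq] lE.
have [ab|ab] := eqVneq a b.
  by subst b; rewrite (IHp a q).
(* Paths that diverge at [x] would glue to a simple path through [x], yet their common endpoint
   occurs in it twice. *)
have : uniq (rev (a :: p) ++ x :: b :: q).
  apply: uniq_cat_at_vertex => /=.
  - by rewrite -rev_cons sorted_adj_rev /= xa.
  - by rewrite -rev_cons rev_uniq /= xp.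
  - by rewrite xb.
  - by rewrite xq.
  - by rewrite rev_cons last_rcons ab !orbT.
rewrite cat_uniq => /and3P[_ /hasPn/(_ (last b q)) + _].
rewrite inE mem_last orbT => /(_ isT); rewrite mem_rev -lE.
by rewrite /= mem_last.
Qed.

Lemma path_vertices (H : graph V) x p :
  path (adj H) x p -> {subset p <= vertices H}.
Proof.
elim: p x => // y p IHp x /= /andP[xy yp] z; rewrite inE => /predU1P[->|].
  by case/andP: (adj_vertices xy).
exact: IHp yp _.
Qed.

(** A path joining the endpoints inside [H] is also a path of [G], so by uniqueness it is [p]. *)
Lemma connected_subgraph_convex H x p :
    subgraph H G -> connected_graph H ->
    path (adj G) x p -> uniq (x :: p) ->
    x \in vertices H -> last x p \in vertices H ->
  {subset x :: p <= vertices H}.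
Proof.
move=> /andP[_ HG] [_ coH] xp up xH lH.
have [q [xq uq lE]] := connect_uniq_path (coH _ _ xH lH).
have -> : p = q.
  apply: (acyclic_path_unique xp up) => //.
  by apply: sub_path xq => a b; exact: (subsetP HG).
move=> z; rewrite inE => /predU1P[-> //|]; exact: path_vertices xq _.
Qed.

Lemma connected_subgraph_convex_nth H x0 s i l j :
    subgraph H G -> connected_graph H -> sorted (adj G) s -> uniq s ->
    i <= l <= j -> j < size s ->
    nth x0 s i \in vertices H -> nth x0 s j \in vertices H ->
  nth x0 s l \in vertices H.
Proof.
move=> HG coH so us /andP[il lj] js iH jH.
pose t := drop i (take j.+1 s).
have st : size t = (j - i).+1 by rewrite size_drop size_takel // subSn //; lia.
have nt k : k <= j - i -> nth x0 t k = nth x0 s (i + k).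
  by move=> kj; rewrite nth_drop nth_take //; lia.
have so_t : sorted (adj G) t by apply/drop_sorted/take_sorted.
have ut : uniq t by apply/drop_uniq/take_uniq.
have lt : nth x0 s l \in t.
  by rewrite -(subnKC il) -nt ?mem_nth ?st //; lia.
have := nt 0 isT; have := nt (j - i) (leqnn _).
case: t st nt so_t ut lt => // y t [st] nt so_t ut lt.
rewrite -st -last_nth addn0 /= => lE yE.
apply: (connected_subgraph_convex HG coH so_t ut) lt; first by rewrite yE.
by rewrite lE st subnKC //; lia.
Qed.

End Acyclic.

(** * The radius lower bound, through a longest path *)

Section LongestPath.
Variables (V : finType) (G : graph V).
Hypothesis treeG : is_tree G.

Definition simple_path (s : seq V) : bool :=
  [&& sorted (adj G) s, uniq s & all (mem (vertices G)) s].

Lemma longest_path : exists s,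
  [/\ simple_path s, 0 < size s & forall t, simple_path t -> size t <= size s].
Proof.
have [[/set0Pn[v vG] _] _] := treeG.
pose P k := [exists s : k.-tuple V, simple_path s].
have exP : exists k, P k.
  by exists 1; apply/existsP; exists [tuple v]; rewrite /simple_path /= vG.
have leP k : P k -> k <= #|V|.
  case/existsP=> s /and3P[_ us _]; rewrite -(size_tuple s) -(card_uniqP us).
  exact: max_card.
case: (ex_maxnP exP leP) => k /existsP[s sP] kmax.
have sizes t : simple_path t -> size t <= size s.
  by move=> tP; rewrite size_tuple kmax //; apply/existsP; exists (in_tuple t).
exists s; split=> //.
by apply: (sizes [:: v]); rewrite /simple_path /= vG.
Qed.

(** A simple path from the middle vertex [m] avoids the first edge of at least one half of [s];
    glued to that half it is a simple path, hence no longer than [s]. *)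
Lemma radius_le_half_path s :
    simple_path s -> 0 < size s ->
    (forall t, simple_path t -> size t <= size s) ->
  radius G <= uphalf (size s).-1.
Proof.
have from_half N q : N./2 + q <= N -> q <= uphalf N by lia.
have from_uphalf N q : uphalf N + q <= N -> q <= uphalf N by lia.
have [[_ coG] acG] := treeG.
move=> /and3P[so us /allP sG] s0 smax.
have x0 : V by case: s s0 {so us sG smax}.
pose h := (size s).-1./2.
have hs : h < size s by rewrite /h; lia.
pose m := nth x0 s h.
have mG : m \in vertices G by apply/sG/mem_nth.
have sE : s = take h s ++ m :: drop h.+1 s by rewrite -drop_nth // cat_take_drop.
have s1 : size (take h s) = h by rewrite size_takel // ltnW.
have s2 : size (drop h.+1 s) = uphalf (size s).-1 by rewrite size_drop /h; lia.
move: (take _ _) (drop _ _) sE s1 s2 => s1 s2 sE s1h s2h.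
suff ecc u : u \in vertices G -> dist G u m <= uphalf (size s).-1.
  apply: leq_trans (bigminn_le _ _ mG) _; exact/bigmax_leqP.
move=> uG; have [q [mq uq lq]] := connect_uniq_path (coG _ _ mG uG).
have du : dist G u m <= size q.
  case: q mq lq {uq} => [|a q] mq lq.
    by rewrite -lq; exact: (@dist_le _ _ m [::]).
  have := @dist_le _ G u (rev (belast m (a :: q))).
  rewrite -lq rev_path (eq_path (e' := adj G)) => [/(_ mq)|x y]; last exact: adj_sym.
  by rewrite size_rev size_belast rev_cons last_rcons.
apply: leq_trans du _.
rewrite sE in so us.
have qG : {subset m :: q <= vertices G}.
  by move=> z; rewrite inE => /predU1P[-> //|]; exact: path_vertices mq _.
have extend t : sorted (adj G) (rcons t m) -> uniq (rcons t m) ->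
    {subset t <= s} -> [|| nilp t, nilp q | last m t != head m q] ->
    size t + size q <= (size s).-1.
  move=> sot ut ts junction.
  rewrite -ltnS prednK // -addnS -[(size q).+1]/(size (m :: q)) -size_cat.
  apply: smax; apply/and3P; split.
  - by rewrite sorted_cat_cons sot; exact: mq.
  - exact: (uniq_cat_at_vertex acG sot ut mq uq junction).
  - rewrite all_cat; apply/andP; split; apply/allP => z.
      by move=> /ts /sG.
    exact: qG.
have := extend s1; have := extend (rev s2).
have so1 : sorted (adj G) (rcons s1 m) by move: so; rewrite sorted_cat_cons => /andP[].
have so2 : sorted (adj G) (m :: s2) by move: so; rewrite sorted_cat_cons => /andP[].
have [u1 u2] : uniq (rcons s1 m) /\ uniq (m :: s2).
  split; first by move: us; rewrite -cat_rcons cat_uniq => /and3P[].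
  by move: us; rewrite cat_uniq => /and3P[].
have sub1 : {subset s1 <= s} by move=> z; rewrite sE mem_cat => ->.
have sub2 : {subset rev s2 <= s}.
  by move=> z; rewrite sE mem_cat mem_rev inE => ->; rewrite !orbT.
rewrite -rev_cons sorted_adj_rev rev_uniq size_rev => /(_ so2 u2 sub2) ext2.
move=> /(_ so1 u1 sub1) ext1.
case: (boolP [|| nilp s1, nilp q | last m s1 != head m q]) => [/ext1|].
  by rewrite s1h => /from_half.
rewrite !negb_or negbK => /and3P[s1n qn /eqP lE].
(* Now [q] starts into [s1], so it cannot also start into [s2], because [s] has no repetition. *)
suff /ext2 : [|| nilp (rev s2), nilp q | last m (rev s2) != head m q].
  by rewrite s2h => /from_uphalf.
rewrite -lE; case: (s2) us => [|a s2'] // us; rewrite rev_cons last_rcons.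
apply/orP; right; apply/orP; right; apply/eqP => aE.
move: us; rewrite cat_uniq => /and3P[_ /hasPn/(_ a) + _].
rewrite !inE eqxx orbT => /(_ isT); rewrite aE.
by case: (s1) s1n => // b s1' _; rewrite /= mem_last.
Qed.

Lemma path_le_separating_system S s :
    separating_tree_system G S -> simple_path s -> (size s).-1 <= #|S|.*2.
Proof.
have [[_ coG] acG] := treeG.
move=> [Strees Ssep] /and3P[so us /allP sG].
case: s so us sG => // x0 s' ; move: (x0 :: s') (ltn0Sn (size s')) => s s0 so us sG.
have nthG i : i < size s -> nth x0 s i \in vertices G by move=> ?; apply/sG/mem_nth.
have /choice[h hP] (l : 'I_(size s).-1) : exists H, H \in S /\
    (nth x0 s l \in vertices H) (+) (nth x0 s l.+1 \in vertices H).
  have ls : l.+1 < size s by have := ltn_ord l; lia.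
  have [|H HS Hsep] := Ssep _ _ (nthG l (ltnW ls)) (nthG l.+1 ls); last by exists H.
  by rewrite nth_uniq ?(ltnW ls) // neq_ltn ltnSn.
(* The flag records whether the path leaves or enters the tree [h l] at step [l]. Convexity allows
   each at most once per tree, so [F] is injective into a set of size [2 |S|]. *)
pose F l := (h l, nth x0 s l \in vertices (h l)).
have noF (l l' : 'I_(size s).-1) : l < l' -> F l <> F l'.
  move=> ll' [hE]; have [hS] := hP l; have [_] := hP l'; rewrite -hE.
  have l's : l'.+1 < size s by have := ltn_ord l'; lia.
  have [HG [coH _]] := Strees _ hS.
  have conv i m j := connected_subgraph_convex_nth (x0 := x0) (i := i) (l := m) (j := j)
    acG HG coH so us.
  move=> sep' sep memE; move: sep sep'; rewrite -memE.
  (* Leaving twice puts [l] and [l'] in [H] but not [l.+1]; entering twice puts [l.+1] and [l'.+1]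
     in [H] but not [l']. *)
  case: (boolP (nth x0 s l \in _)) => lH /= sep sep'.
    move/negP: sep; apply; apply: (conv l l.+1 l') => //; rewrite -?memE //; lia.
  by move/negP: lH; rewrite memE; apply; apply: (conv l.+1 l' l'.+1) => //; lia.
have injF : injective F.
  move=> l l' FE; apply/val_inj.
  by case: (ltngtP l l') => // /noF; [case|rewrite FE; case].
rewrite -[leqLHS]card_ord -(card_codom injF) -muln2 -card_bool -cardsT -cardsX.
apply/subset_leq_card/subsetP => _ /codomP[l ->].
by rewrite !inE andbT; case: (hP l).
Qed.

Lemma radius_le_separating_system S :
  separating_tree_system G S -> radius G <= #|S|.
Proof.
move=> sepS; have [s [sP s0 smax]] := longest_path.
have := radius_le_half_path sP s0 smax.
have := path_le_separating_system sepS sP; lia.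
Qed.

End LongestPath.

(** * Minimum systems and the counting bound *)

Section SeparatingSystems.
Variables (V : finType) (G : graph V).

Lemma f_T_attained : exists2 S, separating_tree_system G S & #|S| = f_T G.
Proof. by rewrite /f_T; case: ex_minnP => m /asboolP. Qed.

Lemma f_T_le S : separating_tree_system G S -> f_T G <= #|S|.
Proof.
by move=> sepS; rewrite /f_T; case: ex_minnP => m _; apply; apply/asboolP; exists S.
Qed.

Lemma card_vertices_le_separating_system S :
  separating_tree_system G S -> #|vertices G| <= 2 ^ #|S|.
Proof.
move=> [_ sepS].
pose F v := [set H in S | v \in vertices H].
have injF : {in vertices G &, injective F}.
  move=> u v uG vG FE; apply/eqP; apply: contraT => uv.
  have [H HS] := sepS u v uG vG uv.
  have := congr1 (fun A : {set graph V} => H \in A) FE.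
  by rewrite !inE HS /= => ->; rewrite addbb.
rewrite -(card_in_imset injF) -card_powerset.
apply/subset_leq_card/subsetP => _ /imsetP[v _ ->]; rewrite powersetE.
by apply/subsetP => H; rewrite inE => /andP[].
Qed.

End SeparatingSystems.

(** * Induced subgraphs *)

Section InducedSubgraph.
Variables (V : finType) (G : graph V) (A : {set V}).

Lemma induced_graph_axiom :
  graph_axiom (A, [set e in edges G | e \subset A]).
Proof.
by apply/forall_inP => e; rewrite inE => /andP[/edgeP/andP[-> _] ->].
Qed.

Definition induced : graph V := Graph induced_graph_axiom.

Lemma adj_induced x y :
  adj induced x y = [&& adj G x y, x \in A & y \in A].
Proof. by rewrite /adj inE subUset !sub1set. Qed.

Lemma subgraph_acyclic (H : graph V) : subgraph H G -> acyclic G -> acyclic H.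
Proof.
move=> /andP[_ HG] acG s /andP[cs us]; apply: acG; rewrite /ucycle us andbT.
by apply: sub_cycle cs => x y; exact: (subsetP HG).
Qed.

Lemma induced_subgraph : A \subset vertices G -> subgraph induced G.
Proof.
by move=> AG; rewrite /subgraph AG; apply/subsetP => e; rewrite inE => /andP[].
Qed.

End InducedSubgraph.

(** * Rooted trees, depth-first keys and the separating construction *)

Section RootedTree.
Variables (V : finType) (G : graph V) (c : V).
Hypotheses (treeG : is_tree G) (cG : c \in vertices G).

Definition level x := dist G x c.

(** The default [x] makes the root a fixed point, so [parent] can be iterated indefinitely. *)
Definition parent x :=
  odflt x [pick y | adj G x y && (level x == (level y).+1)].

Lemma level_root : level c = 0.
Proof. by apply/eqP; rewrite -leqn0; exact: (@dist_le _ G c [::]). Qed.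

Lemma parent_root : parent c = c.
Proof. by rewrite /parent; case: pickP => // y; rewrite level_root andbF. Qed.

Lemma parentP x : x \in vertices G -> x != c ->
  adj G x (parent x) /\ level x = (level (parent x)).+1.
Proof.
move=> xG xc; have [[_ coG] _] := treeG.
suff [y xy ly] : exists2 y, adj G x y & level x = (level y).+1.
  rewrite /parent; case: pickP => [z /andP[? /eqP ?]//|/(_ y)].
  by rewrite xy ly eqxx.
have [_ [[|y p] [xp _ lE sE]]] := dist_attained (coG _ _ xG cG).
  by rewrite -lE eqxx in xc.
case/andP: xp => xy yp; exists y => //.
have [_ [q [yq _ qE qs]]] : _ /\ _ := dist_attained (coG _ _ (proj2 (andP (adj_vertices xy))) cG).
apply/eqP; rewrite eqn_leq; apply/andP; split.
  by rewrite /level -qs -qE; apply: (@dist_le _ G x (y :: q)); rewrite /= xy.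
by rewrite /level -sE ltnS -lE; exact: dist_le.
Qed.

Lemma parent_vertices x : x \in vertices G -> parent x \in vertices G.
Proof.
move=> xG; have [->|xc] := eqVneq x c; first by rewrite parent_root.
by have [/adj_vertices/andP[]] := parentP xG xc.
Qed.

Lemma level_parent x : x \in vertices G -> level (parent x) = (level x).-1.
Proof.
move=> xG; have [->|xc] := eqVneq x c; first by rewrite parent_root level_root.
by have [_ ->] := parentP xG xc.
Qed.

(** Following parents joins every vertex of [A] to the root without leaving [A]; acyclicity is
    inherited from [G]. *)
Lemma induced_tree (A : {set V}) :
    A \subset vertices G -> c \in A -> {in A, forall x, parent x \in A} ->
  subgraph (induced G A) G /\ is_tree (induced G A).
Proof.
move=> AG cA parA; have subA := induced_subgraph AG.
split=> //; split; last by apply: subgraph_acyclic subA _; case: treeG.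
split; first by apply/set0Pn; exists c.
have to_root m x : level x = m -> x \in A -> connect (adj (induced G A)) x c.
  elim: m x => [|m IHm] x xm xA; have xG := subsetP AG x xA;
    have [->//|xc] := eqVneq x c; have [xp lp] := parentP xG xc.
    by rewrite lp in xm.
  apply: connect_trans (IHm _ _ (parA _ xA)); last by apply: succn_inj; rewrite -lp.
  by apply: connect1; rewrite adj_induced xp xA parA.
move=> x y xA yA; apply: connect_trans (to_root _ _ erefl xA) _.
rewrite (sym_connect_sym (adj_sym _)); exact: to_root yA.
Qed.

Definition ball i := [set x in vertices G | level x <= i].

Lemma ball_tree i : subgraph (induced G (ball i)) G /\ is_tree (induced G (ball i)).
Proof.
apply: induced_tree.
- by apply/subsetP => x; rewrite inE => /andP[].
- by rewrite inE cG level_root.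
- move=> x; rewrite !inE => /andP[xG xi].
  by rewrite parent_vertices // level_parent // (leq_trans (leq_pred _)).
Qed.

(** The union of the paths from the root to [S]; adding [c] keeps it nonempty when [S] is empty. *)
Definition root_hull (S : {set V}) :=
  c |: [set u in vertices G | [exists x in S, fconnect parent x u]].

Lemma root_hull_tree S :
  subgraph (induced G (root_hull S)) G /\ is_tree (induced G (root_hull S)).
Proof.
apply: induced_tree.
- by apply/subsetP => x /setU1P[->|] //; rewrite inE => /andP[].
- exact: setU11.
- move=> u /setU1P[->|]; first by rewrite parent_root setU11.
  rewrite inE => /andP[uG /exists_inP[x xS xu]]; apply/setU1P; right.
  rewrite inE parent_vertices //; apply/exists_inP; exists x => //.
  exact: connect_trans xu (fconnect1 _ _).
Qed.

Definition ancestor i x := iter (level x - i) parent x.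

Lemma iter_parent_vertices m x :
  x \in vertices G -> iter m parent x \in vertices G.
Proof. by move=> xG; elim: m => //= m; exact: parent_vertices. Qed.

Lemma ancestor_iter_parent m i x : x \in vertices G ->
  i <= level (iter m parent x) -> ancestor i (iter m parent x) = ancestor i x.
Proof.
move=> xG; elim: m => //= m IHm.
have := iter_parent_vertices m xG; move: (iter m parent x) IHm => y IHm yG.
have [yc|yc] := eqVneq y c; first by rewrite yc parent_root -yc.
have [_ ly] := parentP yG yc => ip.
rewrite -IHm; last by rewrite ly ltnW.
by rewrite /ancestor ly subSn // iterSr.
Qed.

Lemma ancestor_fconnect i x u : x \in vertices G -> fconnect parent x u ->
  i <= level u -> ancestor i x = ancestor i u.
Proof. by move=> xG /iter_findex <- ?; rewrite ancestor_iter_parent. Qed.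

(* Reads the first [i] vertices of the path from the root to [x] as a number in
   base [#|V|], so that keys compare these paths lexicographically; below [x] the path is
   padded with copies of [x], by the truncated subtraction in [ancestor]. *)
Fixpoint key i x : nat :=
  if i is i'.+1 then key i' x * #|V| + enum_rank (ancestor i' x) else 0.

(** The root path of a descendant [x] of [u] begins with that of [u], which has [(level u).+1]
    vertices. *)
Lemma key_fconnect i x u : x \in vertices G -> fconnect parent x u ->
  i <= (level u).+1 -> key i x = key i u.
Proof.
move=> xG xu; elim: i => //= i IHi iu.
by rewrite (ancestor_fconnect xG xu) // IHi // ltnW.
Qed.

(** Digits are below the base, so appended digits cannot undo a strict inequality. *)
Lemma key_ltn_mono i j x y : i <= j -> key i x < key i y -> key j x < key j y.
Proof.
move=> /subnKC <-; elim: (j - i) => [|d IHd] lt_i; rewrite ?addn0 // addnS /=.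
apply: leq_trans (leq_trans (leq_mul (IHd lt_i) (leqnn #|V|)) (leq_addr _ _)).
by rewrite mulSn addnC ltn_add2r ltn_ord.
Qed.

(** The last digit of each key is the rank of the vertex itself. *)
Lemma key_level_neq u v : level u = level v -> u != v ->
  key (level u).+1 u != key (level u).+1 v.
Proof.
move=> luv; apply: contra_neq => /= /(congr1 (modn^~ #|V|)).
rewrite !modnMDl !modn_small ?ltn_ord // /ancestor -luv !subnn /=.
by move/ord_inj/enum_rank_inj.
Qed.

Section Labels.
Variable r : nat.
Hypothesis level_le : {in vertices G, forall x, level x <= r}.

(* Ranking brings the keys below [2 ^ k], as needed for [separating_bit]. *)
Definition label x := #|[set w in vertices G | key r.+1 w < key r.+1 x]|.

Lemma label_lt x : x \in vertices G -> label x < #|vertices G|.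
Proof.
move=> xG; apply/proper_card/properP; split.
  by apply/subsetP => w; rewrite inE => /andP[].
by exists x; rewrite // inE ltnn andbF.
Qed.

Lemma label_ltn_mono x y : x \in vertices G ->
  key r.+1 x < key r.+1 y -> label x < label y.
Proof.
move=> xG xy; apply/proper_card/properP; split.
  by apply/subsetP => w; rewrite !inE => /andP[-> /ltn_trans->].
by exists x; rewrite !inE ?xG ?xy // ltnn.
Qed.

Variable k : nat.
Hypothesis card_le : #|vertices G| <= 2 ^ k.

Definition bit_set (jb : 'I_k * bool) :=
  [set x in vertices G | odd (label x %/ 2 ^ jb.1) == jb.2].

Definition separators : {set graph V} :=
  [set induced G (ball (val i)) | i in 'I_r]
    :|: [set induced G (root_hull (bit_set jb)) | jb : 'I_k * bool].

Lemma card_separators : #|separators| <= r + k.*2.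
Proof.
apply: leq_trans (leq_card_setU _ _) _; apply: leq_add.
  by apply: leq_trans (leq_imset_card _ _) _; rewrite card_ord.
apply: leq_trans (leq_imset_card _ _) _.
by rewrite card_prod card_ord card_bool muln2.
Qed.

Lemma separate_levels u v : u \in vertices G -> v \in vertices G ->
    level u < level v ->
  exists2 H, H \in separators & (u \in vertices H) (+) (v \in vertices H).
Proof.
move=> uG vG uv; have ur : level u < r by rewrite (leq_trans uv) ?level_le.
exists (induced G (ball (level u))).
  by apply/setUP; left; apply/imsetP; exists (Ordinal ur).
by rewrite !inE uG vG leqnn leqNgt uv.
Qed.

(** Descendants inherit the strict order of these keys, so every label below [u] is less than every
    label below [v]. A hull contains a vertex other than the root exactly when its bit set meets the
    descendants of that vertex. *)
Lemma separate_key u v : u \in vertices G -> v \in vertices G ->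
    level u = level v -> key (level u).+1 u < key (level u).+1 v ->
  exists2 H, H \in separators & (u \in vertices H) (+) (v \in vertices H).
Proof.
move=> uG vG luv kuv.
pose D w := [set x in vertices G | fconnect parent x w].
have uv : u != v by apply/eqP => uv; rewrite uv ltnn in kuv.
(* The root lies in every hull, so it has to be excluded; it is alone on its level. *)
have root w w' : w \in vertices G -> w' \in vertices G -> w != w' ->
    level w = level w' -> w != c.
  move=> wG w'G ww' lw; apply: contra_neq ww' => wc; rewrite wc.
  apply/esym/eqP; apply: contraT => w'c.
  by have [_] := parentP w'G w'c; rewrite -lw wc level_root.
have uc := root u v uG vG uv luv.
have vc := root v u vG uG (contra_neq esym uv) (esym luv).
(* [separating_bit] wants a bound on all of [V], while [label_lt] holds on the vertices of [G]. *)
pose f x := if x \in vertices G then label x else 0.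
have [] := @separating_bit _ f (D u) (D v) k.
- by apply/set0Pn; exists u; rewrite inE uG connect0.
- by apply/set0Pn; exists v; rewrite inE vG connect0.
- move=> x; rewrite /f; case: ifP => [xG|_]; last by rewrite expn_gt0.
  exact: leq_trans (label_lt xG) card_le.
- move=> x y; rewrite !inE => /andP[xG xu] /andP[yG yv].
  rewrite /f xG yG; apply: label_ltn_mono => //.
  apply: (@key_ltn_mono (level u).+1); first by rewrite ltnS level_le.
  by rewrite (key_fconnect xG xu) // (key_fconnect yG yv) // luv.
move=> j [b sep]; exists (induced G (root_hull (bit_set (j, b)))).
  by apply/setUP; right; apply/imsetP; exists (j, b).
have hullE w : w \in vertices G -> w != c ->
    (w \in vertices (induced G (root_hull (bit_set (j, b)))))
      = [exists x in D w, odd (f x %/ 2 ^ j) == b].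
  move=> wG wc; rewrite !inE (negbTE wc) wG /=.
  apply/exists_inP/exists_inP => -[x xI xb]; exists x.
  - by rewrite inE xb andbT; move: xI; rewrite inE => /andP[].
  - by move: xI; rewrite inE /f => /andP[-> /=].
  - by move: xI; rewrite !inE => /andP[xG _]; move: xb; rewrite /f xG => ->.
  - by move: xI; rewrite inE => /andP[].
by rewrite !hullE.
Qed.

Lemma separators_separate : separating_tree_system G separators.
Proof.
split.
  by move=> H /setUP[] /imsetP[? _ ->]; [exact: ball_tree|exact: root_hull_tree].
move=> u v uG vG uv.
have swap : (exists2 H, H \in separators & (v \in vertices H) (+) (u \in vertices H)) ->
    exists2 H, H \in separators & (u \in vertices H) (+) (v \in vertices H).
  by move=> [H HS sep]; exists H; rewrite // addbC.
case: (ltngtP (level u) (level v)) => luv; first exact: separate_levels.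
  by apply: swap; exact: separate_levels.
case: (ltngtP (key (level u).+1 u) (key (level u).+1 v)) => kuv.
- exact: separate_key.
- by apply: swap; apply: separate_key => //; rewrite -luv.
- by have := key_level_neq luv uv; rewrite kuv eqxx.
Qed.

End Labels.

End RootedTree.

(** * Centers, logarithms and the final bounds *)

Lemma radius_attained (V : finType) (G : graph V) : connected_graph G ->
  exists2 c, c \in vertices G &
    {in vertices G, forall u, dist G u c <= radius G}.
Proof.
move=> [/set0Pn[v vG] coG].
(* Being below the default value, the minimum is attained at an actual vertex. *)
have rV : radius G < #|V|.
  apply: leq_ltn_trans (bigminn_le _ _ vG) _.
  have V0 : 0 < #|V| by apply/card_gt0P; exists v.
  by rewrite -(prednK V0) ltnS; apply/bigmax_leqP => u uG;
     rewrite -ltnS prednK //; case: (dist_attained (coG u v uG vG)).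
have [c cG rE] := bigminn_attained rV; exists c => // u uG.
by rewrite /radius rE; apply: leq_bigmax_cond.
Qed.

Lemma f_T_upper_bound (V : finType) (G : graph V) k :
  is_tree G -> #|vertices G| <= 2 ^ k -> f_T G <= radius G + k.*2.
Proof.
move=> treeG nk; have [coG _] := treeG; have [c cG lev] := radius_attained coG.
exact: leq_trans (f_T_le (separators_separate treeG cG lev nk)) (card_separators _ _ _ _).
Qed.

Local Open Scope ring_scope.

Lemma log2_le (R : realType) (n k : nat) : (0 < n)%N ->
  (log2 (n%:R : R) <= k%:R) = (n <= 2 ^ k)%N.
Proof.
move=> n0; have ln2 : 0 < ln 2 :> R by rewrite ln_gt0 // ltr1n.
rewrite /log2 ler_pdivrMr // mulr_natl -lnXn // -natrX ler_ln ?ler_nat //.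
all: by rewrite posrE ltr0n ?expn_gt0.
Qed.

Unset Implicit Arguments.

Theorem theorem22 (R : realType) (V : finType) (T : graph V) (n r : nat)
    (hn4 : (4 <= n)%N) (hn : #|vertices T| = n) (hT : is_tree T)
    (hr : radius T = r) :
  Num.max r%:R (log2 (n%:R : R)) <= (f_T T)%:R /\
  (f_T T)%:R <= r%:R + 2 * (Num.ceil (log2 (n%:R : R)))%:~R + 1 :> R.
Proof.
have n0 : (0 < n)%N by apply: leq_trans hn4.
have [S sepS cardS] := f_T_attained T; split.
  rewrite ge_max ler_nat log2_le // -cardS -hr -hn.
  by rewrite radius_le_separating_system // card_vertices_le_separating_system.
set l := log2 _; have l0 : 0 <= l.
  by rewrite /l /log2 divr_ge0 // ln_ge0 // ler1n.
(* The ceiling of the nonnegative [l] serves as the number of label bits. *)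
have [k kE] : exists k : nat, Num.ceil l = k%:Z.
  by exists `|Num.ceil l|%N; rewrite gez0_abs // ceil_ge0 // (lt_le_trans _ l0) // ltrN10.
have nk : (#|vertices T| <= 2 ^ k)%N.
  by rewrite hn -(log2_le R) // -/l (le_trans (ceil_ge l)) // kE.
rewrite kE -pmulrn -natrM -natrD -[1]/(1%:R) -natrD ler_nat.
by apply: leq_trans (f_T_upper_bound hT nk) _; rewrite hr mul2n leq_addr.
Qed.
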